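(* Let $\mu$ be a finitely supported aperiodic probability measure on a group $G$, let $H(n)=H(\mu^{*n})$ be the entropy of its $n$-th convolution, and let $f(n)$ be a function such that $$f(n)\sqrt{H(n+1)-H(n)}\to 0\quad\text{as } n\to\infty .$$ Then the distributions of the random walk $(G,\mu)$ are individually almost invariant on the scale $f(n)$.
   Context: $G$ is a group generated by a finite set $S$, with word length $l_{G,S}$, and $\mu^{*n}$ is the $n$-th convolution power of $\mu$. The entropy of a probability measure $\nu$ on a space $X$ is $H(\nu)=-\sum_{x\in X}\nu(x)\log\nu(x)$. The period of a probability measure $\mu$ on $G$ is the greatest common divisor of the integers $K\ge 0$ such that $\mu^{*K}(e)>0$, where $e$ is the identity of $G$; $\mu$ is aperiodic if its period equals one. The random walk $(G,\mu)$ has individually almost invariant distributions on the scale $r(n)$ if for all $\epsilon>0$ and all sequences $g_n\in G$ satisfying $l_{G,S}(g_n)\le r(n)$ there exist subsets $V_{\epsilon,n}\subset G$ such that $\mu^{*n}(V_{\epsilon,n})\ge 1-\epsilon$ and such that for any sequence $h_n\in V_{\epsilon,n}$ it holds $|\mu^{*n}(h_ng_n)/\mu^{*n}(h_n)-1|\le\epsilon$.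
   Formalization: The support of μ is assumed to generate G as a group (otherwise μ=δ_e on Z with f=1 is a counterexample), and the almost-invariance estimates are required only for all sufficiently large n (for every n the claim fails, as f(1) is unconstrained). *)

(* Defs.v *)
From HB Require Import structures.
From mathcomp Require Import all_boot all_order all_algebra all_fingroup.
From mathcomp Require Import all_classical all_reals all_analysis.

Set Implicit Arguments.
Unset Strict Implicit.
Unset Printing Implicit Defensive.

Import Order.TTheory GRing.Theory Num.Theory.
Import numFieldNormedType.Exports.

Local Open Scope classical_set_scope.
Local Open Scope ring_scope.

Section Words.
Variable G : groupType.
Implicit Types (S : set G) (g : G) (w : seq G).

Definition is_word S w : Prop := forall x, x \in w -> S x \/ S (x^-1)%g.

Definition is_word_for S g w : Prop := is_word S w /\ g = (\prod_(x <- w) x)%g.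

Definition generates S : Prop := forall g, exists w, is_word_for S g w.

(* The default value 0 is only used when no word over S represents g. *)
Definition word_length S g : nat :=
  xget 0%N [set k | (exists2 w, is_word_for S g w & size w = k) /\
                    forall w, is_word_for S g w -> (k <= size w)%N].

End Words.

(* The greatest common divisor of a set of naturals; it is 0 for A included in
   {0}, and 0 \in A never changes it. *)
Definition gcd_set (A : set nat) : nat :=
  xget 0%N [set d | (forall k, A k -> d %| k)%N /\
                    (forall e, (forall k, A k -> e %| k) -> e %| d)%N].

(* A measure on a discrete space X is represented by its mass function X -> R.
   The sums \sum_(x \in A) _ are finitely supported sums (0 by convention when
   the summand has infinite support); they are used for finitely supported
   masses only. *)
Section Masses.
Variable R : realType.

Definition supp (X : choiceType) (nu : X -> R) : set X := [set x | nu x != 0].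

Definition fin_probability (X : choiceType) (nu : X -> R) : Prop :=
  [/\ forall x, 0 <= nu x, finite_set (supp nu) & \sum_(x \in [set: X]) nu x = 1].

Definition mass (X : choiceType) (nu : X -> R) (A : set X) : R :=
  \sum_(x \in A) nu x.

(* Since ln 0 = 0, points of zero mass contribute 0. *)
Definition entropy (X : choiceType) (nu : X -> R) : R :=
  - \sum_(x \in [set: X]) nu x * ln (nu x).

Variable G : groupType.
Implicit Types (mu nu : G -> R).

Definition convolution mu nu : G -> R :=
  fun g => \sum_(h \in [set: G]) mu h * nu (h^-1 * g)%g.

Definition dirac_one : G -> R := fun g => (g == 1%g)%:R.

Definition conv_pow mu (n : nat) : G -> R :=
  iter n (fun nu => convolution nu mu) dirac_one.

Definition period mu : nat := gcd_set [set k | 0 < conv_pow mu k 1%g].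

Definition aperiodic mu : Prop := period mu = 1%N.

(* The estimates are asymptotic: they are required for all large n. The scale r
   is real-valued. Since x / 0 = 0, for eps < 1 the last bound forces every
   point of V n to have positive mass, so the quotient is then a genuine one. *)
Definition individually_almost_invariant (S : set G) mu (r : nat -> R) : Prop :=
  forall eps : R, 0 < eps ->
  forall g : nat -> G, (forall n, (word_length S (g n))%:R <= r n) ->
  exists V : nat -> set G, \forall n \near \oo,
    1 - eps <= mass (conv_pow mu n) (V n) /\
    forall h : G, V n h ->
      `|conv_pow mu n (h * g n)%g / conv_pow mu n h - 1| <= eps.

End Masses.

(* Main.v *)
Require Import Defs.
From mathcomp Require Import all_boot all_order all_algebra all_fingroup.
From mathcomp Require Import all_classical all_reals all_analysis.
From mathcomp Require Import ring lra.

(** Write p_n for the n-th convolution power of mu and delta_n for the entropy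
    increment H(n+1) - H(n).  Every estimate is in l^1 norm, and the target is
    | p_n (. g) - p_n |_1 <= C l(g) sqrt(delta_n), with C depending on mu and S
    only.

    Entropy.  The law p_(n+1) is the mixture, with weights mu s, of the right
    translates of p_n by the points s of the support of mu, and all these
    translates have the entropy of p_n.  Hence delta_n is the average, with
    weights mu s, of the relative entropies of the translates with respect to
    the mixture, and a Pinsker type inequality bounds the distance from each
    translate to p_(n+1) by a constant times sqrt(delta_n)
    ([l1_dist_le_entropy]).

    Propagation.  Since p_(n+1) is also the convolution of mu by p_n on the
    other side, and left convolution by mu contracts l^1 and commutes with right
    translations, an estimate valid at time n is valid at all later times with
    the same bound ([l1_dist_le_conv_pow_add]).  Later entropy increments thus
    never enter.

    Group structure.  Call (g, k) an almost shift if
    | p_n (. g) - p_(n+k) |_1 <= C sqrt(delta_n) for a constant C and all n.  By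
    propagation the almost shifts are closed under product and quotient in
    G x Z, up to the order of the factors ([almost_shiftD], [almost_shiftB]).  They contain (s^-1, 1) for s in
    the support of mu by the entropy step, hence (g^-1, k) as soon as
    p_k g > 0; in particular they contain (1, k) for every return time k.
    Aperiodicity and Euclidean division give (1, 1), so (s, 0) for s in the
    support, and finally (g, 0) for every g, since the support generates G
    ([almost_shift_space]).

    Conclusion.  Adding up along a shortest word gives the target
    ([l1_dist_le_word_length]).  If l(g_n) <= f n, the right-hand side tends to
    0, and the Markov inequality turns l^1 closeness into closeness of ratios
    outside a set of small mass ([mass_almost_invariant]). *)

Set Implicit Arguments.
Unset Strict Implicit.
Unset Printing Implicit Defensive.

Import Order.TTheory GRing.Theory Num.Theory.
Import numFieldNormedType.Exports.

Local Open Scope classical_set_scope.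
Local Open Scope ring_scope.

(** * Sums of finitely supported functions *)

Section FiniteSums.
Variables (R : realType) (X : choiceType).
Implicit Types (F nu : X -> R) (r : seq X).

Lemma fsumT_seq r F : uniq r -> (forall x, x \notin r -> F x = 0) ->
  \sum_(x \in [set: X]) F x = \sum_(x <- r) F x.
Proof.
move=> ur F0; rewrite (fsbigE r)//; last by move=> x _; apply: F0.
by apply: eq_bigl => x; rewrite in_setT.
Qed.

Lemma supp_seq nu : finite_set (supp nu) ->
  exists2 r : seq X, uniq r & forall x, (nu x != 0) = (x \in r).
Proof.
move=> /finite_seqP[r rE]; exists (undup r); first exact: undup_uniq.
move=> x; rewrite mem_undup; apply/idP/idP.
  by move=> nx; have : supp nu x by []; rewrite rE.
by move=> xr; have : [set` r] x by []; rewrite -rE.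
Qed.

Lemma le_sum_subset r1 r2 F : uniq r1 -> uniq r2 -> (forall x, 0 <= F x) ->
  (forall x, x \notin r2 -> F x = 0) -> \sum_(x <- r1) F x <= \sum_(x <- r2) F x.
Proof.
move=> u1 u2 F_ge0 F0.
rewrite (bigID (mem r2))/= [X in _ + X]big1_seq => [|x /andP[/F0]//].
rewrite addr0 -big_filter [leRHS](bigID (mem r1))/=.
rewrite -[X in _ <= X + _]big_filter.
rewrite (perm_big [seq x <- r2 | x \in r1]) ?lerDl ?sumr_ge0//=.
apply: uniq_perm; rewrite ?filter_uniq// => x.
by rewrite !mem_filter andbC.
Qed.

End FiniteSums.

(** * Distance in l^1 norm *)

Section L1.
Variables (R : realType) (G : groupType).
Implicit Types (a b c : G -> R) (C D : R).

(** The norm | a - b |_1 is the supremum of the finite partial sums; bounding all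
    of them states the inequality without any summability or support
    condition. *)
Definition l1_dist_le a b C : Prop :=
  forall r : seq G, uniq r -> \sum_(x <- r) `|a x - b x| <= C.

Lemma l1_dist_le_sym a b C : l1_dist_le a b C -> l1_dist_le b a C.
Proof.
by move=> h r ur; under eq_bigr do rewrite distrC; exact: h.
Qed.

Lemma l1_dist_le_trans b a c C D :
  l1_dist_le a b C -> l1_dist_le b c D -> l1_dist_le a c (C + D).
Proof.
move=> h1 h2 r ur; apply: le_trans (lerD (h1 r ur) (h2 r ur)).
by rewrite -big_split/=; apply: ler_sum => x _; exact: ler_distD.
Qed.

Lemma l1_dist_le_weaken a b C D : C <= D -> l1_dist_le a b C -> l1_dist_le a b D.
Proof. by move=> CD h r ur; exact: le_trans (h r ur) CD. Qed.

Lemma l1_dist_le_reindex (h : G -> G) a b C : injective h ->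
  l1_dist_le a b C -> l1_dist_le (a \o h) (b \o h) C.
Proof.
move=> h_inj ab r ur.
by have := ab (map h r); rewrite big_map map_inj_uniq//; exact.
Qed.

(** Convexity of the norm. *)
Lemma l1_dist_le_mixture (T : Type) (s : seq T) (w : T -> R) (a b : T -> G -> R) C :
  (forall t, 0 <= w t) -> \sum_(t <- s) w t = 1 ->
  (forall t, l1_dist_le (a t) (b t) C) ->
  l1_dist_le (fun x => \sum_(t <- s) w t * a t x)
             (fun x => \sum_(t <- s) w t * b t x) C.
Proof.
move=> w_ge0 w1 ab r ur.
have -> : C = \sum_(t <- s) w t * C by rewrite -mulr_suml w1 mul1r.
apply: (@le_trans _ _ (\sum_(x <- r) \sum_(t <- s) w t * `|a t x - b t x|)).
  apply: ler_sum => x _; rewrite -sumrB; apply: le_trans (ler_norm_sum _ _ _) _.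
  by apply: ler_sum => t _; rewrite -mulrBr normrM ger0_norm.
rewrite exchange_big/=; apply: ler_sum => t _.
by rewrite -mulr_sumr ler_wpM2l//; exact: ab.
Qed.

End L1.

(** * A Pinsker type inequality *)

Section Hellinger.
Variable R : realType.

(** This is ln u <= u - 1 at u = sqrt (q / p).  Once summed over two probability
    laws, p - q cancels and the squared Hellinger distance is bounded by the
    relative entropy. *)
Lemma hellinger_le_kullback (p q : R) : 0 <= p -> 0 <= q -> (0 < p -> 0 < q) ->
  p - q + (Num.sqrt p - Num.sqrt q) ^+ 2 <= p * (ln p - ln q).
Proof.
move=> p_ge0 q_ge0 pq.
have [p0|p_le0] := ltP 0 p; last first.
  have -> : p = 0 by apply/eqP; rewrite eq_le p_le0.
  by rewrite sqrtr0 !sub0r sqrrN sqr_sqrtr// mul0r; lra.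
have q0 := pq p0.
have a0 : 0 < Num.sqrt p by rewrite sqrtr_gt0.
have b0 : 0 < Num.sqrt q by rewrite sqrtr_gt0.
rewrite -{1 3 4}(sqr_sqrtr p_ge0) -{1 3}(sqr_sqrtr q_ge0).
move: a0 b0; set a := Num.sqrt p; set b := Num.sqrt q => a0 b0.
have lnle : ln b - ln a <= b / a - 1.
  have -> : ln b - ln a = ln (1 + (b / a - 1)).
    by rewrite [1 + _]addrC subrK ln_div ?posrE.
  by apply: le_ln1Dx; have := divr_gt0 b0 a0; lra.
rewrite !lnXn//.
have : a ^+ 2 * (ln b - ln a) <= a ^+ 2 * (b / a - 1) by rewrite ler_wpM2l// sqr_ge0.
have -> : a ^+ 2 * (b / a - 1) = a * b - a ^+ 2 by field; rewrite gt_eqF.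
by rewrite !mulr2n; lra.
Qed.

(** Cauchy-Schwarz applied to
    |p - q| = |sqrt p - sqrt q| (sqrt p + sqrt q), the second factor having
    square at most 2 (p + q), of total mass at most 4. *)
Lemma l1_le_hellinger (X : eqType) (r : seq X) (p q : X -> R) (D : R) :
  (forall x, 0 <= p x) -> (forall x, 0 <= q x) ->
  \sum_(x <- r) p x <= 1 -> \sum_(x <- r) q x <= 1 ->
  \sum_(x <- r) (Num.sqrt (p x) - Num.sqrt (q x)) ^+ 2 <= D ->
  \sum_(x <- r) `|p x - q x| <= 2 * Num.sqrt D.
Proof.
move=> p0 q0 p1 q1 hD.
have D0 : 0 <= D by apply: le_trans hD; apply: sumr_ge0 => x _; exact: sqr_ge0.
(* Cauchy-Schwarz in the form of Young's inequality, optimal at t = sqrt D. *)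
have bnd (t : R) : 0 < t -> \sum_(x <- r) `|p x - q x| <= D / t + t.
  move=> t0.
  apply: (@le_trans _ _ (\sum_(x <- r)
      ((Num.sqrt (p x) - Num.sqrt (q x)) ^+ 2 / t + t * ((p x + q x) / 2)))).
    apply: ler_sum => x _.
    have := sqr_sqrtr (p0 x); have := sqr_sqrtr (q0 x).
    have := sqrtr_ge0 (p x); have := sqrtr_ge0 (q x).
    move: (Num.sqrt (p x)) (Num.sqrt (q x)) => a b b0 a0 <- <-.
    rewrite subr_sqr normrM (ger0_norm (addr_ge0 a0 b0)).
    rewrite -(real_normK (num_real (a - b))).
    have : a ^+ 2 + b ^+ 2 >= (a + b) ^+ 2 / 2 by have := sqr_ge0 (a - b); lra.
    move: (a ^+ 2 + b ^+ 2) (a + b) `|a - b| => m s d hm.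
    apply: (@le_trans _ _ (d ^+ 2 / t + t * (s ^+ 2 / 4))); last first.
      by rewrite lerD2l; apply: ler_wpM2l; [exact: ltW | lra].
    have -> : d ^+ 2 / t + t * (s ^+ 2 / 4) = d * s + t * (d / t - s / 2) ^+ 2.
      by field; rewrite gt_eqF.
    by rewrite lerDl mulr_ge0 ?sqr_ge0 ?ltW.
  rewrite big_split/= -mulr_suml -mulr_sumr -mulr_suml big_split/=.
  apply: lerD; first by rewrite ler_wpM2r// invr_ge0 ltW.
  by rewrite -[leRHS]mulr1; apply: ler_wpM2l; [exact: ltW | lra].
have [D00|Dp] := leP D 0; last first.
  have sp : 0 < Num.sqrt D by rewrite sqrtr_gt0.
  apply: le_trans (bnd _ sp) _.
  rewrite -{1}(sqr_sqrtr D0) expr2 mulfK ?gt_eqF//; lra.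
have {D00} D_0 : D = 0 by apply/eqP; rewrite eq_le D00.
rewrite D_0 sqrtr0 mulr0; apply/ler_addgt0Pr => e e0.
by have := bnd e e0; rewrite D_0 mul0r add0r.
Qed.

End Hellinger.

(** * Convolution and entropy *)

Section Convolution.
Variables (R : realType) (G : groupType).
Implicit Types (mu nu : G -> R) (T : seq G).

Lemma fsumT_mulr (F : G -> R) (g : G) :
  \sum_(x \in [set: G]) F (x * g)%g = \sum_(x \in [set: G]) F x.
Proof.
rewrite [RHS](@reindex_fsbigT _ _ _ G G (fun x => x * g)%g)//.
by exists (fun x => x * g^-1)%g => x; rewrite (mulgK, mulgKV).
Qed.

Lemma convolution_seq mu nu T : uniq T -> (forall x, x \notin T -> mu x = 0) ->
  forall g, convolution nu mu g = \sum_(s <- T) mu s * nu (g * s^-1)%g.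
Proof.
move=> uT mu0 g; rewrite /convolution.
rewrite (@reindex_fsbigT _ _ _ G G (fun s => g * s^-1)%g)/=; last first.
  by exists (fun x => x^-1 * g)%g => x; rewrite invgM invgK (mulgKV, mulVKg).
rewrite (@fsumT_seq _ _ T)//.
  by apply: eq_bigr => s _; rewrite mulrC invgM invgK mulgKV.
by move=> s /mu0 sT; rewrite invgM invgK mulgKV sT mulr0.
Qed.

Lemma prob_seq nu : fin_probability nu ->
  exists T, [/\ uniq T, forall x, x \notin T -> nu x = 0,
                forall x, x \in T -> 0 < nu x & \sum_(x <- T) nu x = 1].
Proof.
move=> [nu_ge0 /supp_seq[T uT TE] nu1].
have nu0 x : x \notin T -> nu x = 0 by rewrite -TE negbK => /eqP.
exists T; split=> //; last by rewrite -nu1 (@fsumT_seq _ _ T).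
by move=> x; rewrite -TE lt0r nu_ge0 andbT.
Qed.

Lemma fin_probability_convolution mu nu :
  fin_probability mu -> fin_probability nu -> fin_probability (convolution nu mu).
Proof.
move=> hmu hnu.
have [T [uT mu0 mup mu1]] := prob_seq hmu.
have [E [uE nu0 nup nu1]] := prob_seq hnu.
have convE := convolution_seq _ uT mu0.
have [mu_ge0 _ _] := hmu; have [nu_ge0 _ nus] := hnu.
pose E' := undup [seq x * s | x <- E, s <- T]%g.
have pE0 s : s \in T -> forall x, x \notin E' -> nu (x * s^-1)%g = 0.
  move=> sT x xE; apply: nu0; apply: contra xE => xE.
  rewrite mem_undup; apply/allpairsP; exists (x * s^-1, s)%g.
  by rewrite /= mulgKV.
have conv0 x : x \notin E' -> convolution nu mu x = 0.
  by move=> xE; rewrite convE big1_seq// => s /andP[_ sT]; rewrite pE0// mulr0.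
split.
- by move=> x; rewrite convE sumr_ge0// => s _; rewrite mulr_ge0.
- apply: (@sub_finite_set _ _ [set` E']) => // x; apply: contraNP => /negP.
  by move=> /conv0 ->.
- rewrite (@fsumT_seq _ _ E') ?undup_uniq//.
  under eq_bigr do rewrite convE.
  rewrite exchange_big/= -mu1; apply: eq_big_seq => s sT.
  rewrite -mulr_sumr -(@fsumT_seq _ _ _ (fun x => nu (x * s^-1)%g)) ?undup_uniq//.
    by rewrite fsumT_mulr nus mulr1.
  exact: pE0.
Qed.

Lemma fin_probability_conv_pow mu n :
  fin_probability mu -> fin_probability (conv_pow mu n).
Proof.
move=> hmu; elim: n => [|n IH]; last exact: fin_probability_convolution.
have d0 x : x \notin [:: 1%g] -> @dirac_one R G x = 0.
  by rewrite inE /dirac_one => /negbTE ->.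
split; rewrite /conv_pow/=.
- by move=> x; rewrite /dirac_one ler0n.
- apply: (@sub_finite_set _ _ [set` [:: 1%g]]) => // x; apply: contraNP => /negP.
  by move=> /d0 ->.
- by rewrite (@fsumT_seq _ _ [:: 1%g])// big_seq1 /dirac_one eqxx.
Qed.

Lemma conv_powS mu n : conv_pow mu n.+1 = convolution (conv_pow mu n) mu.
Proof. by []. Qed.

(** Powers of mu commute with mu.  Splitting off the first increment instead of
    the last one yields an operator that commutes with right translations. *)
Lemma conv_powSl mu T : uniq T -> (forall x, x \notin T -> mu x = 0) ->
  forall n g, conv_pow mu n.+1 g = \sum_(s <- T) mu s * conv_pow mu n (s^-1 * g)%g.
Proof.
move=> uT mu0; elim=> [|n IH] g.
  rewrite conv_powS (convolution_seq _ uT mu0); apply: eq_bigr => s _; congr (_ * _).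
  rewrite /conv_pow /= /dirac_one; congr (_ %:R); congr nat_of_bool.
  by rewrite -(can_eq (mulgK s)) mulgKV mul1g -[RHS](can_eq (mulKg s)) mulVKg mulg1.
rewrite conv_powS (convolution_seq _ uT mu0).
under eq_bigr do rewrite IH mulr_sumr.
rewrite exchange_big/=; apply: eq_bigr => s _.
rewrite (convolution_seq _ uT mu0) mulr_sumr.
by apply: eq_bigr => t _; rewrite mulrCA mulgA.
Qed.

Lemma entropy_seq nu T : uniq T -> (forall x, x \notin T -> nu x = 0) ->
  entropy nu = - \sum_(x <- T) nu x * ln (nu x).
Proof.
by move=> uT nu0; rewrite /entropy (@fsumT_seq _ _ T)// => x /nu0 ->; rewrite mul0r.
Qed.

Lemma entropy_mulr nu g : entropy (fun x => nu (x * g)%g) = entropy nu.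
Proof.
by rewrite /entropy (fsumT_mulr (fun x => nu x * ln (nu x))).
Qed.

(** The entropy increment is the average over the law mu of the relative
    entropies of the translates of nu with respect to their mixture
    [convolution nu mu]; these terms being nonnegative, the one of index s is at
    most the increment divided by mu s. *)
Lemma l1_dist_le_entropy mu nu s : fin_probability mu -> fin_probability nu ->
  0 < mu s ->
  l1_dist_le (fun x => nu (x * s^-1)%g) (convolution nu mu)
    (2 * Num.sqrt (mu s)^-1 * Num.sqrt (entropy (convolution nu mu) - entropy nu)).
Proof.
move=> hmu hnu mus.
have [T [uT mu0 mup mu1]] := prob_seq hmu.
have hq := fin_probability_convolution hmu hnu.
have [E [uE q0 qp q1]] := prob_seq hq.
have convE := convolution_seq nu uT mu0.
have [mu_ge0 _ _] := hmu; have [nu_ge0 _ nus] := hnu; have [q_ge0 _ _] := hq.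
set q := convolution nu mu in hq q0 qp q1 convE q_ge0 *.
have mulT x t : t \in T -> mu t * nu (x * t^-1)%g <= q x.
  move=> tT; rewrite convE (bigD1_seq t)//= lerDl.
  by apply: sumr_ge0 => u _; rewrite mulr_ge0.
have pq0 t x : t \in T -> 0 < nu (x * t^-1)%g -> 0 < q x.
  by move=> tT h; apply: lt_le_trans (mulT x t tT); rewrite mulr_gt0// mup.
have p0 t x : t \in T -> x \notin E -> nu (x * t^-1)%g = 0.
  move=> tT xE; apply/eqP; rewrite eq_le nu_ge0 andbT leNgt.
  by apply/negP => /(pq0 _ _ tT); rewrite q0// ltxx.
have p1 t : t \in T -> \sum_(x <- E) nu (x * t^-1)%g = 1.
  move=> tT; rewrite -(@fsumT_seq _ _ _ (fun x => nu (x * t^-1)%g))//.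
    by rewrite fsumT_mulr.
  by move=> x; apply: p0.
(* The squared Hellinger distance from the translate by t to the mixture. *)
pose A t := \sum_(x <- E) (Num.sqrt (nu (x * t^-1)%g) - Num.sqrt (q x)) ^+ 2.
have HE : entropy q - entropy nu = \sum_(t <- T)
    mu t * \sum_(x <- E) nu (x * t^-1)%g * (ln (nu (x * t^-1)%g) - ln (q x)).
  transitivity (\sum_(t <- T) mu t *
      (- (\sum_(x <- E) nu (x * t^-1)%g * ln (q x)) - entropy nu)).
    under eq_bigr do rewrite mulrBr.
    rewrite sumrB -mulr_suml mu1 mul1r (@entropy_seq q E)//; congr (_ - _).
    under [RHS]eq_bigr do rewrite mulrN mulr_sumr.
    rewrite sumrN exchange_big/=; congr (- _); apply: eq_bigr => x _.
    rewrite {1}convE mulr_suml.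
    by apply: eq_bigr => t _; rewrite mulrA.
  apply: eq_big_seq => t tT; congr (_ * _).
  rewrite -(entropy_mulr nu t^-1) (@entropy_seq _ E)//; last first.
    by move=> x; apply: p0.
  by rewrite opprK addrC -sumrB; apply: eq_bigr => x _; rewrite mulrBr.
have sT : s \in T by apply/negPn/negP => /mu0 h; rewrite h ltxx in mus.
have AH : mu s * A s <= entropy q - entropy nu.
  rewrite HE; apply: (@le_trans _ _ (\sum_(t <- T) mu t * A t)).
    rewrite (bigD1_seq s)//= lerDl; apply: sumr_ge0 => t _.
    by rewrite mulr_ge0//; apply: sumr_ge0 => x _; exact: sqr_ge0.
  rewrite [X in X <= _]big_seq [X in _ <= X]big_seq.
  apply: ler_sum => t tT; rewrite ler_wpM2l//.
  apply: le_trans (_ : \sum_(x <- E) (nu (x * t^-1)%g - q x +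
    (Num.sqrt (nu (x * t^-1)%g) - Num.sqrt (q x)) ^+ 2) <= _).
    by rewrite big_split/= sumrB p1// q1 subrr add0r.
  apply: ler_sum => x _; apply: hellinger_le_kullback => //.
  exact: pq0.
move=> r ur; apply: le_trans (le_sum_subset _ uE _ _) _ => //.
  by move=> x xE; rewrite p0// q0// subrr normr0.
rewrite -mulrA -sqrtrM ?invr_ge0//; apply: l1_le_hellinger => //.
- by rewrite p1.
- by rewrite q1.
- by rewrite mulrC ler_pdivlMr// mulrC.
Qed.

End Convolution.

(** * Almost shifts of the random walk in space and time *)

Section SpaceTimeShifts.
Variables (R : realType) (G : groupType).
Implicit Types (mu : G -> R) (rate : nat -> R) (g h : G) (k l n : nat).

(** Left convolution by mu contracts l^1 and commutes with right translations. *)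
Lemma l1_dist_le_conv_pow_add mu g k n m C : fin_probability mu ->
  l1_dist_le (fun x => conv_pow mu n (x * g)%g) (conv_pow mu k) C ->
  l1_dist_le (fun x => conv_pow mu (n + m) (x * g)%g) (conv_pow mu (k + m)) C.
Proof.
move=> hmu nk; have [T [uT mu0 _ mu1]] := prob_seq hmu.
have [mu_ge0 _ _] := hmu.
elim: m => [|m IH]; first by rewrite !addn0.
have stepE j x : conv_pow mu (j + m.+1) x =
    \sum_(s <- T) mu s * conv_pow mu (j + m) (s^-1 * x)%g.
  by rewrite addnS (conv_powSl uT mu0).
move=> r ur; under eq_bigr do rewrite !stepE.
apply: (l1_dist_le_mixture
  (a := fun s x => conv_pow mu (n + m) (s^-1 * (x * g))%g)
  (b := fun s x => conv_pow mu (k + m) (s^-1 * x)%g)) ur => // s.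
have := l1_dist_le_reindex (mulgI s^-1%g) IH.
by under [X in l1_dist_le X _ _]funext do rewrite /= -mulgA.
Qed.

(** The constant must not depend on n, so that [rate] alone carries the
    dependence on time. *)
Definition almost_shift mu rate g k : Prop := exists C, forall n,
  l1_dist_le (fun x => conv_pow mu n (x * g)%g) (conv_pow mu (n + k)) (C * rate n).

Lemma almost_shift1 mu rate : almost_shift mu rate 1%g 0.
Proof.
exists 0 => n r _; rewrite mul0r big1// => x _.
by rewrite mulg1 addn0 subrr normr0.
Qed.

(** The shift by (h, l) is used at time n + k, where the bound of time n still
    holds: this is why the constants add up against the same [rate n]. *)
Lemma almost_shiftD mu rate g h k l : fin_probability mu ->
  almost_shift mu rate g k -> almost_shift mu rate h l ->
  almost_shift mu rate (h * g)%g (k + l).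
Proof.
move=> hmu [C hC] [D hD]; exists (C + D) => n.
rewrite mulrDl.
apply: (@l1_dist_le_trans _ _ (fun x => conv_pow mu (n + k) (x * h)%g)).
  have := l1_dist_le_reindex (mulIg h) (hC n).
  by under [X in l1_dist_le X _ _]funext do rewrite /= -mulgA.
have := l1_dist_le_conv_pow_add k hmu (hD n).
by rewrite addnAC addnA.
Qed.

(** With p_n for the powers of mu, both p_n (. h) and p_(n+l) (. g) are close to
    p_(n+k+l); translating by g^-1 compares p_n (. g^-1 h) with p_(n+l). *)
Lemma almost_shiftB mu rate g h k l : fin_probability mu ->
  almost_shift mu rate g k -> almost_shift mu rate h (k + l) ->
  almost_shift mu rate (g^-1 * h)%g l.
Proof.
move=> hmu [C hC] [D hD]; exists (D + C) => n.
rewrite mulrDl.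
apply: (@l1_dist_le_trans _ _ (fun x => conv_pow mu (n + k + l) (x * g^-1)%g)).
  have := l1_dist_le_reindex (mulIg g^-1%g) (hD n).
  by under [X in l1_dist_le X _ _]funext do rewrite /= -mulgA; rewrite addnA.
have := l1_dist_le_conv_pow_add l hmu (hC n).
move=> /l1_dist_le_sym /(l1_dist_le_reindex (mulIg g^-1%g)).
by under [X in l1_dist_le _ X _]funext do rewrite /= mulgKV.
Qed.

Definition entropy_rate mu n : R :=
  Num.sqrt (entropy (conv_pow mu n.+1) - entropy (conv_pow mu n)).

Lemma almost_shift_supp mu s : fin_probability mu -> 0 < mu s ->
  almost_shift mu (entropy_rate mu) s^-1%g 1.
Proof.
move=> hmu mus; exists (2 * Num.sqrt (mu s)^-1) => n.
rewrite addn1; apply: l1_dist_le_entropy => //.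
exact: fin_probability_conv_pow.
Qed.

(** A point charged by the k-th power is a product of k points of the support, and
    almost shifts multiply. *)
Lemma almost_shift_conv_pow mu k g : fin_probability mu -> 0 < conv_pow mu k g ->
  almost_shift mu (entropy_rate mu) g^-1%g k.
Proof.
move=> hmu; elim: k g => [|k IH] g.
  rewrite /conv_pow/= /dirac_one; case: eqP => [->|]; last by rewrite ltxx.
  by move=> _; rewrite invg1; exact: almost_shift1.
have [T [uT mu0 mup _]] := prob_seq hmu.
have [nu_ge0 _ _] := fin_probability_conv_pow k hmu.
rewrite conv_powS (convolution_seq _ uT mu0) => gk.
have [s sT] : exists2 s, s \in T & conv_pow mu k (g * s^-1)%g != 0.
  apply: contrapT => none; move: gk; rewrite big1_seq ?ltxx// => s /andP[_ sT].
  have [->|ne] := eqVneq (conv_pow mu k (g * s^-1)%g) 0; first by rewrite mulr0.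
  by case: none; exists s.
move=> ne; have /IH : 0 < conv_pow mu k (g * s^-1)%g by rewrite lt0r ne nu_ge0.
move=> /(almost_shiftD hmu)/(_ (almost_shift_supp hmu (mup s sT))).
by rewrite addn1 invgM invgK mulKg.
Qed.

End SpaceTimeShifts.

(** * Aperiodicity *)

(** The hypotheses say that A is the nonnegative part of a subgroup of Z, which is
    generated by its least positive element. *)
Lemma dvdn_of_subgroup (A : set nat) : A 0%N ->
  (forall k l, A k -> A l -> A (k + l)%N) ->
  (forall k l, A k -> A (k + l)%N -> A l) ->
  exists2 d, A d & forall k, A k -> (d %| k)%N.
Proof.
move=> A0 AD AB.
have [[k [Ak k_gt0]]|none] := pselect (exists k, A k /\ (0 < k)%N); last first.
  exists 0%N => // k Ak; case: k Ak => // k Ak.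
  by case: none; exists k.+1.
have exP : exists k, `[< A k /\ (0 < k)%N >] by exists k; apply/asboolP.
have [d /asboolP[Ad d_gt0] dmin] := ex_minnP exP.
exists d => // m Am; rewrite /dvdn eqn0Ngt; apply/negP => r_gt0.
have Aq : forall q, A (q * d)%N.
  by elim=> [|q IH]; rewrite ?mul0n// mulSn; exact: AD.
have /dmin : `[< A (m %% d)%N /\ (0 < m %% d)%N >].
  by apply/asboolP; split=> //; apply: AB (Aq (m %/ d)%N) _; rewrite -divn_eq.
by rewrite leqNgt ltn_pmod.
Qed.

Section Aperiodic.
Variables (R : realType) (G : groupType).
Implicit Types (mu : G -> R) (S : set G) (g : G).

(** The case d = 0 is excluded as well: a walk that never returns at a positive
    time has period 0. *)
Lemma aperiodic_dvdn1 mu d : aperiodic mu ->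
  (forall k, 0 < conv_pow mu k 1%g -> (d %| k)%N) -> d = 1%N.
Proof.
rewrite /aperiodic /period /gcd_set; case: xgetP => [p _ [_ gcdP] p1|//].
by move=> /gcdP; rewrite p1 dvdn1 => /eqP.
Qed.

Lemma almost_shift_time mu : fin_probability mu -> aperiodic mu ->
  almost_shift mu (entropy_rate mu) 1%g 1.
Proof.
move=> hmu aper.
have [|k l hk hl|k l hk hkl|d hd dvd_d] :=
    @dvdn_of_subgroup [set k | almost_shift mu (entropy_rate mu) 1%g k].
- exact: almost_shift1.
- by have := almost_shiftD hmu hk hl; rewrite mulg1.
- by have := almost_shiftB hmu hk hkl; rewrite invg1 mulg1.
rewrite -(aperiodic_dvdn1 aper (d := d))// => k /(almost_shift_conv_pow hmu).
by rewrite invg1; exact: dvd_d.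
Qed.

(** The quotient of (s^-1, 1) by (1, 1) removes the shift in time, after which
    closure under products and inverses reaches the whole group. *)
Lemma almost_shift_space mu : fin_probability mu -> aperiodic mu ->
  generates (supp mu) -> forall g, almost_shift mu (entropy_rate mu) g 0.
Proof.
move=> hmu aper gen g.
have inv h : almost_shift mu (entropy_rate mu) h 0 ->
    almost_shift mu (entropy_rate mu) h^-1%g 0.
  move=> hh; rewrite -[h^-1%g]mulg1.
  by apply: (almost_shiftB hmu hh); exact: almost_shift1.
have supp_shift s : supp mu s -> almost_shift mu (entropy_rate mu) s 0.
  have [mu_ge0 _ _] := hmu.
  move=> s0; have /(almost_shift_supp hmu) sV : 0 < mu s by rewrite lt0r mu_ge0 andbT.
  rewrite -[s]invgK; apply: inv; rewrite -[s^-1%g]mul1g -[X in (X * _)%g]invg1.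
  by apply: (almost_shiftB hmu (almost_shift_time hmu aper)); rewrite addn0.
have [w [ww ->]] := gen g.
elim: w ww => [|x w IH] ww; first by rewrite big_nil; exact: almost_shift1.
rewrite big_cons -[0%N]addn0; apply: (almost_shiftD hmu).
  by apply: IH => y yw; apply: ww; rewrite inE yw orbT.
have [sx|sx] := ww x (mem_head _ _); first exact: supp_shift.
by rewrite -[x]invgK; apply: inv; exact: supp_shift.
Qed.

(** * From generators to balls, and from l^1 to ratios *)

Lemma word_lengthP S g : generates S ->
  exists2 w, is_word_for S g w & size w = word_length S g.
Proof.
move=> gen; rewrite /word_length.
have [w ww] := gen g.
have exP : exists k, `[< exists2 w, is_word_for S g w & size w = k >].
  by exists (size w); apply/asboolP; exists w.
have [k /asboolP kw kmin] := ex_minnP exP.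
case: xgetP => [_ _ [] //|none]; case: (none k); split=> // v vw.
by apply: kmin; apply/asboolP; exists v.
Qed.

(** Finiteness of S makes the constant uniform over the letters; each letter of a
    shortest word then costs one use of it. *)
Lemma l1_dist_le_word_length mu S : finite_set S -> generates S ->
  fin_probability mu -> aperiodic mu -> generates (supp mu) ->
  exists2 C, 0 <= C & forall g n,
    l1_dist_le (fun x => conv_pow mu n (x * g)%g) (conv_pow mu n)
      ((word_length S g)%:R * (C * entropy_rate mu n)).
Proof.
move=> /finite_seqP[E SE] gen hmu aper gen_mu.
have bnd (g : G) : {C : R | forall n, l1_dist_le (fun x => conv_pow mu n (x * g)%g)
    (conv_pow mu n) (C * entropy_rate mu n)}.
  apply: cid; have [C hC] := almost_shift_space hmu aper gen_mu g.
  by exists C => n; have := hC n; rewrite addn0.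
pose c g := sval (bnd g).
(* Summing both constants of each generator dominates all of them at once. *)
pose C := \sum_(x <- E) (`|c x| + `|c x^-1%g|).
have rate_ge0 n : 0 <= entropy_rate mu n by exact: sqrtr_ge0.
have cE x : x \in E -> `|c x| + `|c x^-1%g| <= C.
  move=> xE; rewrite /C (perm_big _ (perm_to_rem xE)) big_cons lerDl.
  by apply: sumr_ge0 => y _; rewrite addr_ge0.
have cC x : S x \/ S x^-1%g -> c x <= C.
  rewrite SE => -[] /cE; apply: le_trans; apply: le_trans (ler_norm _) _.
    by rewrite lerDl.
  by rewrite invgK lerDr.
exists C; first by apply: sumr_ge0 => y _; rewrite addr_ge0.
move=> g n; have [w [ww ->] <-] := word_lengthP g gen.
elim: w ww => [|x w IH] ww.
  rewrite big_nil mul0r => r _; rewrite big1// => y _.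
  by rewrite mulg1 subrr normr0.
rewrite big_cons /= -addn1 natrD mulrDl mul1r.
apply: (@l1_dist_le_trans _ _ (fun y => conv_pow mu n (y * x)%g)).
  have /IH/(l1_dist_le_reindex (mulIg x)) : is_word S w.
    by move=> y yw; apply: ww; rewrite inE yw orbT.
  by under [X in l1_dist_le X _ _]funext do rewrite /= -mulgA.
apply: l1_dist_le_weaken (svalP (bnd x) n).
by apply: ler_wpM2r => //; apply/cC/ww/mem_head.
Qed.

(** Markov inequality: a point x of positive mass outside the set contributes more
    than eps times nu x to the l^1 distance, which is at most eps ^+ 2. *)
Lemma mass_almost_invariant (nu : G -> R) g (eps : R) : fin_probability nu -> 0 < eps ->
  l1_dist_le (fun x => nu (x * g)%g) nu (eps ^+ 2) ->
  1 - eps <= mass nu [set h | 0 < nu h /\ `|nu (h * g)%g - nu h| <= eps * nu h].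
Proof.
move=> hnu eps0 close; have [T [uT nu0 nup nu1]] := prob_seq hnu.
have [nu_ge0 _ _] := hnu.
set V := [set h | _]; rewrite /mass fsbig_mkcond (@fsumT_seq _ _ T)//; last first.
  by move=> x xT; rewrite patchE; case: ifP => // _; exact: nu0.
rewrite lerBlDr -lerBlDl -nu1 -sumrB.
apply: le_trans (_ : eps^-1 * \sum_(x <- T) `|nu (x * g)%g - nu x| <= _); last first.
  rewrite mulrC ler_pdivrMr// -expr2; exact: close.
rewrite mulr_sumr [leLHS]big_seq [leRHS]big_seq; apply: ler_sum => x xT.
rewrite patchE; case: ifPn => [_|].
  by rewrite subrr mulr_ge0// invr_ge0 ltW.
rewrite subr0 mulrC ler_pdivlMr// mulrC notin_setE => xV.
by rewrite leNgt; apply/negP => h; apply: xV; split; [exact: nup | exact: ltW].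
Qed.

End Aperiodic.

Theorem corollary2p11 (R : realType) (G : groupType) (S : set G)
    (S_finite : finite_set S) (S_generates : generates S)
    (mu : G -> R) (mu_probability : fin_probability mu)
    (mu_generates : generates (supp mu)) (mu_aperiodic : aperiodic mu)
    (f : nat -> R)
    (f_scale : (fun n : nat => f n *
        Num.sqrt (entropy (conv_pow mu n.+1) - entropy (conv_pow mu n)))
      @ \oo --> (0 : R)) :
  individually_almost_invariant S mu f.
Proof.
move=> eps eps0 g gf.
have [C C_ge0 hC] := l1_dist_le_word_length S_finite S_generates mu_probability
  mu_aperiodic mu_generates.
exists (fun n => [set h | 0 < conv_pow mu n h /\
  `|conv_pow mu n (h * g n)%g - conv_pow mu n h| <= eps * conv_pow mu n h]).
(* C + 1 rather than C, which may vanish. *)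
have e2 : 0 < eps ^+ 2 / (C + 1).
  by rewrite divr_gt0 ?exprn_gt0// ltr_wpDl.
have f_rate : \forall n \near \oo,
    `|f n * entropy_rate mu n| < eps ^+ 2 / (C + 1).
  move/cvgr0Pnorm_lt : f_scale; exact.
near=> n; split.
  apply: mass_almost_invariant => //; first exact: fin_probability_conv_pow.
  apply: l1_dist_le_weaken (hC (g n) n).
  have fn : `|f n * entropy_rate mu n| < eps ^+ 2 / (C + 1).
    by near: n.
  have : f n * entropy_rate mu n <= eps ^+ 2 / (C + 1).
    by apply: ltW; apply: le_lt_trans fn; exact: ler_norm.
  rewrite ler_pdivlMr ?ltr_wpDl// => {}fn; apply: le_trans fn.
  rewrite mulrCA mulrC; apply: ler_pM.
  - by rewrite mulr_ge0// sqrtr_ge0.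
  - by [].
  - by rewrite ler_wpM2r// sqrtr_ge0.
  - by rewrite lerDl.
move=> h [h0 hh].
rewrite -[X in _ - X](mulfV (lt0r_neq0 h0)) -mulrBl normrM normfV.
by rewrite (gtr0_norm h0) ler_pdivrMr.
Unshelve. all: by end_near.
Qed.
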